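(* Consider the problem in the $2n$ blocks $x_1,\dots,x_{2n}$ $$(\mathrm{P})\qquad \min_{x_1,\dots,x_{2n}}\ \sum_{i=1}^n f_i(x_i)+\sum_{i=1}^n\chi_{X_i}(x_{n+i})\quad\text{s.t.}\quad \sum_{i=1}^n\mathcal{A}_i(x_i)=b,\quad x_i-x_{n+i}=0,\ i=1,\dots,n .$$ If $\{\beta_k\}$ is non-decreasing and upper bounded, and the parameters satisfy $\eta_i>n\|\mathcal{A}_i\|^2+2$ and $\eta_{n+i}>2$ for $i=1,\dots,n$, then the sequence $\{(x_1^k,\dots,x_{2n}^k,\lambda^k)\}$ generated by LADMPSAP applied to (P) converges to a KKT point of (P).
   Context: Data: $f_i:\mathbb{R}^{d_i}\to\mathbb{R}\cup\{+\infty\}$ closed proper convex, $\mathcal{A}_i:\mathbb{R}^{d_i}\to\mathbb{R}^m$ linear with adjoint $\mathcal{A}_i^\dagger$ and operator norm $\|\mathcal{A}_i\|$, $b\in\mathbb{R}^m$, $X_i\subsetneq\mathbb{R}^{d_i}$ closed convex sets; $\chi_{X}(x)=0$ if $x\in X$ and $+\infty$ otherwise; $\|\cdot\|$ is the Euclidean (Frobenius) norm. (P) reformulates $\min\sum_i f_i(x_i)$ s.t. $\sum_i\mathcal{A}_i(x_i)=b$, $x_i\in X_i$. Standing assumptions: no $\mathcal{A}_i$ is zero; the solution of $\sum_i\mathcal{A}_i(x_i)=b$ is non-unique; $(x_1,\dots,x_n)\mapsto\sum_i\mathcal{A}_i(x_i)$ is onto; $b$ is an interior point of $\sum_{i=1}^n\mathcal{A}_i(X_i)$;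 (P) has a KKT point. Write $f_{n+i}=\chi_{X_i}$ and write the constraints of (P) as $\sum_{i=1}^{2n}\hat{\mathcal{A}}_i(x_i)=\hat b$ with $\hat b=(b,0,\dots,0)$, where, with $n+1$ components (the first in $\mathbb{R}^m$, the $(j+1)$-th in $\mathbb{R}^{d_j}$), $\hat{\mathcal{A}}_i(x_i)$ has first component $\mathcal{A}_i(x_i)$, $(i+1)$-th component $x_i$ and other components $0$, and $\hat{\mathcal{A}}_{n+i}(x_{n+i})$ has $(i+1)$-th component $-x_{n+i}$ and other components $0$, $i=1,\dots,n$. Multipliers $\lambda=(\lambda_1,\dots,\lambda_{n+1})$ are partitioned accordingly. A KKT point of (P) is $(x_1^*,\dots,x_{2n}^*,\lambda^* )$ with $\sum_{i=1}^{2n}\hat{\mathcal{A}}_i(x_i^* )=\hat b$ and $-\hat{\mathcal{A}}_i^\dagger(\lambda^* )\in\partial f_i(x_i^* )$ for $i=1,\dots,2n$, i.e. $-\mathcal{A}_i^\dagger(\lambda_1^* )-\lambda_{i+1}^*\in\partial f_i(x_i^* )$ and $\lambda_{i+1}^*\in\partial\chi_{X_i}(x_{n+i}^* )$ for $i=1,\dots,n$. LADMPSAP for (P), with $\beta_k>0$, initialized at any $x_i^0$, $x_{n+i}^0=x_i^0$ ($i=1,\dots,n$), any $\lambda^0$, and run without stopping: for $i=1,\dots,n$, $$\hat\lambda_1^k=\lambda_1^k+\beta_k\Big(\sum_{j=1}^n\mathcal{A}_j(x_j^k)-b\Big),\qquad \hat\lambda_{i+1}^k=\lambda_{i+1}^k+\beta_k(x_i^k-x_{n+i}^k),$$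 $$x_i^{k+1}=\operatorname*{argmin}_{x} f_i(x)+\frac{\eta_i\beta_k}{2}\Big\|x-x_i^k+\frac{\mathcal{A}_i^\dagger(\hat\lambda_1^k)+\hat\lambda_{i+1}^k}{\eta_i\beta_k}\Big\|^2,\qquad x_{n+i}^{k+1}=\pi_{X_i}\Big(x_{n+i}^k+\frac{\hat\lambda_{i+1}^k}{\eta_{n+i}\beta_k}\Big),$$ $$\lambda_1^{k+1}=\lambda_1^k+\beta_k\Big(\sum_{j=1}^n\mathcal{A}_j(x_j^{k+1})-b\Big),\qquad \lambda_{i+1}^{k+1}=\lambda_{i+1}^k+\beta_k(x_i^{k+1}-x_{n+i}^{k+1}),$$ where $\pi_{X_i}$ is the Euclidean projection onto $X_i$. *)

(* Defs.v *)
From HB Require Import structures.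
From mathcomp Require Import all_boot all_order all_algebra.
From mathcomp Require Import all_classical all_reals all_analysis.

Set Implicit Arguments.
Unset Strict Implicit.
Unset Printing Implicit Defensive.

Import Order.TTheory GRing.Theory Num.Theory.
Import numFieldNormedType.Exports.

Local Open Scope classical_set_scope.
Local Open Scope ring_scope.

Section Euclidean.
Context {R : realType}.

Definition dotv d (u v : 'cV[R]_d) : R := \sum_(i < d) u i 0 * v i 0.

(* The library norm `|u| on 'cV[R]_d is the sup norm, hence this definition;
   both norms induce the canonical topology of 'cV[R]_d. *)
Definition l2norm d (u : 'cV[R]_d) : R := Num.sqrt (dotv u u).

(* A linear map R^d -> R^m is given by its matrix acting on column vectors;
   its adjoint for dotv is the transpose A^T. *)
Definition opnorm m d (A : 'M[R]_(m, d)) : R :=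
  sup [set l2norm (A *m x) | x in [set x : 'cV[R]_d | l2norm x <= 1]].

Definition is_projection d (X : set 'cV[R]_d) (u p : 'cV[R]_d) : Prop :=
  X p /\ forall z, X z -> l2norm (u - p) <= l2norm (u - z).

End Euclidean.

Section ConvexAnalysis.
Context {R : realType}.
Local Open Scope ereal_scope.

Definition proper_fun d (f : 'cV[R]_d -> \bar R) : Prop :=
  (forall x, f x != -oo) /\ exists x, f x < +oo.

(* Meaningful for functions that do not take the value -oo. *)
Definition convex_efun d (f : 'cV[R]_d -> \bar R) : Prop :=
  forall (x y : 'cV[R]_d) (t : R), (0 < t < 1)%R ->
    f (t *: x + (1 - t) *: y)%R <= t%:E * f x + (1 - t)%:E * f y.

(* For proper functions, closedness is lower semicontinuity. *)
Definition closed_proper_convex d (f : 'cV[R]_d -> \bar R) : Prop :=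
  [/\ lower_semicontinuous f, proper_fun f & convex_efun f].

Definition indicator d (X : set 'cV[R]_d) (x : 'cV[R]_d) : \bar R :=
  if x \in X then 0 else +oo.

Definition subdiff d (f : 'cV[R]_d -> \bar R) (x : 'cV[R]_d) :
    set 'cV[R]_d :=
  [set g | forall y, f x + (dotv g (y - x))%:E <= f y].

Definition is_argmin (T : Type) (F : T -> \bar R) (x : T) : Prop :=
  forall y, F x <= F y.

End ConvexAnalysis.

(* A point (x_1, ..., x_2n, lambda_1, ..., lambda_(n+1)); with i : 'I_n,
     px i = x_i,  py i = x_(n+i),  pmu = lambda_1,  pnu i = lambda_(i+1)
   where indices on the right-hand sides start at 1. *)
Record pdpoint (R : realType) (n m : nat) (d : 'I_n -> nat) := PdPoint {
  px : forall i : 'I_n, 'cV[R]_(d i);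
  py : forall i : 'I_n, 'cV[R]_(d i);
  pmu : 'cV[R]_m;
  pnu : forall i : 'I_n, 'cV[R]_(d i)
}.

Unset Implicit Arguments.

Section Ladmpsap.
Context {R : realType} {n m : nat} {d : 'I_n -> nat}.
Variables (f : forall i : 'I_n, 'cV[R]_(d i) -> \bar R).
Variables (A : forall i : 'I_n, 'M[R]_(m, d i)) (b : 'cV[R]_m).
Variable X : forall i : 'I_n, set 'cV[R]_(d i).

Definition Asum (x : forall i : 'I_n, 'cV[R]_(d i)) : 'cV[R]_m :=
  \sum_(i < n) A i *m x i.

Definition is_KKT (p : pdpoint R m d) : Prop :=
  [/\ Asum (px p) = b,
      forall i, px p i - py p i = 0,
      forall i, subdiff (f i) (px p i) (- ((A i)^T *m pmu p) - pnu p i)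
    & forall i, subdiff (indicator (X i)) (py p i) (pnu p i)].

Variables (eta eta' : 'I_n -> R).

(* One iteration with penalty beta, from s to s'; eta i and eta' i are the
   parameters eta_i and eta_(n+i). *)
Definition ladmpsap_step (beta : R) (s s' : pdpoint R m d) : Prop :=
  let hmu := pmu s + beta *: (Asum (px s) - b) in
  let hnu i := pnu s i + beta *: (px s i - py s i) in
  [/\ forall i, is_argmin
        (fun x : 'cV[R]_(d i) => (f i x +
          (eta i * beta / 2 *
           l2norm (x - px s i +
                   (eta i * beta)^-1 *: ((A i)^T *m hmu + hnu i)) ^+ 2)%:E)%E)
        (px s' i),
      forall i, is_projection (X i)
        (py s i + (eta' i * beta)^-1 *: hnu i) (py s' i),
      pmu s' = pmu s + beta *: (Asum (px s') - b)
    & forall i, pnu s' i = pnu s i + beta *: (px s' i - py s' i)].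

Definition is_ladmpsap_run (beta : nat -> R) (s : nat -> pdpoint R m d) : Prop :=
  (forall i, py (s 0%N) i = px (s 0%N) i) /\
  forall k, ladmpsap_step (beta k) (s k) (s k.+1).

Definition point_cvg (s : nat -> pdpoint R m d) (p : pdpoint R m d) : Prop :=
  [/\ forall i, px (s k) i @[k --> \oo] --> px p i,
      forall i, py (s k) i @[k --> \oo] --> py p i,
      pmu (s k) @[k --> \oo] --> pmu p
    & forall i, pnu (s k) i @[k --> \oo] --> pnu p i].

End Ladmpsap.

(* Main.v *)
Require Import Defs.
From HB Require Import structures.
From mathcomp Require Import all_boot all_order all_algebra.
From mathcomp Require Import all_classical all_reals all_analysis.
From mathcomp Require Import ring lra.

(** Fix a KKT point q, with blocks x^q and y^q (y_i stands for x_(n+i)) and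
    multipliers lambda^q, and measure the k-th iterate by
<<
      V_k = sum_i eta_i |x_i - x_i^q|^2 + sum_i eta'_i |y_i - y_i^q|^2
            + beta_k^-2 |lambda - lambda^q|^2 .
>>
    Each block update is a proximal step, so its optimality condition exhibits
    an explicit subgradient at the new block (a projection is the proximal
    step of an indicator function).  Subdifferentials are monotone: when these
    subgradients are compared with those of the KKT conditions of q and the
    block inequalities are added, the multipliers are only paired with the
    constraint residual at the new point, that is, with their own increment
    divided by beta_k.  What comes out is an inequality between squared
    distances with a single unfavourable term, the squared norm of the image
    of the primal displacement under the constraint map; it arises because all
    blocks move simultaneously, using predicted multipliers.  It is estimated by
    |v_1 + ... + v_n|^2 <= n (|v_1|^2 + ... + |v_n|^2) in the coupling
    constraint and by |u - v|^2 <= 2 |u|^2 + 2 |v|^2 in each constraint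
    x_i = y_i; the thresholds on eta_i and eta'_i are exactly what lets the
    squared displacements absorb it.  This is [lyapunov_descent].
    Since beta is non-decreasing, replacing beta_k by beta_(k+1) can only
    lower V, so V_k is non-increasing and the loss at each step dominates the
    squared displacements and the squared constraint residuals, which hence
    tend to 0.

    As beta is bounded, a bound on V bounds the iterates, multipliers included.
    An ultrafilter finer than the neighbourhoods of infinity then makes all
    blocks converge at once, which replaces the extraction of a common
    subsequence.  Displacements and residuals vanish in the limit, so the
    subgradients of the proximal steps tend to those required by the KKT
    conditions, and lower semicontinuity makes the subdifferentials closed:
    the limit p is a KKT point ([KKT_cluster]).  The descent now applies to
    p itself: V relative to p is non-increasing and becomes arbitrarily small,
    so it tends to 0, and the whole sequence converges to p ([run_cvg]). *)

Set Implicit Arguments.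
Unset Strict Implicit.
Unset Printing Implicit Defensive.

Import Order.TTheory GRing.Theory Num.Theory.
Import numFieldNormedType.Exports.

Local Open Scope classical_set_scope.
Local Open Scope ring_scope.

(** * Squared Euclidean norm *)

Local Notation sqn u := (dotv u u).

Section InnerProduct.
Context {R : realType}.

Lemma dotvC d (u v : 'cV[R]_d) : dotv u v = dotv v u.
Proof. by apply: eq_bigr => i _; rewrite mulrC. Qed.

Lemma dotvDl d (u v w : 'cV[R]_d) : dotv (u + v) w = dotv u w + dotv v w.
Proof. by rewrite /dotv -big_split; apply: eq_bigr => i _; rewrite !mxE mulrDl. Qed.

Lemma dotvDr d (u v w : 'cV[R]_d) : dotv w (u + v) = dotv w u + dotv w v.
Proof. by rewrite dotvC dotvDl !(dotvC w). Qed.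

Lemma dotvZl d a (u w : 'cV[R]_d) : dotv (a *: u) w = a * dotv u w.
Proof. by rewrite /dotv mulr_sumr; apply: eq_bigr => i _; rewrite !mxE mulrA. Qed.

Lemma dotvZr d a (u w : 'cV[R]_d) : dotv w (a *: u) = a * dotv w u.
Proof. by rewrite dotvC dotvZl dotvC. Qed.

Lemma dotvNl d (u w : 'cV[R]_d) : dotv (- u) w = - dotv u w.
Proof. by rewrite -scaleN1r dotvZl mulN1r. Qed.

Lemma dotvNr d (u w : 'cV[R]_d) : dotv w (- u) = - dotv w u.
Proof. by rewrite dotvC dotvNl dotvC. Qed.

Lemma dotv0l d (w : 'cV[R]_d) : dotv 0 w = 0.
Proof. by rewrite -(scale0r 0) dotvZl mul0r. Qed.

Lemma dotv_suml d (I : finType) (u : I -> 'cV[R]_d) w :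
  dotv (\sum_i u i) w = \sum_i dotv (u i) w.
Proof.
apply: (big_ind2 (fun a b => dotv a w = b)) => //; first exact: dotv0l.
by move=> ? ? ? ? <- <-; rewrite dotvDl.
Qed.

Lemma dotv_sumr d (I : finType) (u : I -> 'cV[R]_d) w :
  dotv w (\sum_i u i) = \sum_i dotv w (u i).
Proof. by rewrite dotvC dotv_suml; apply: eq_bigr => i _; rewrite dotvC. Qed.

Lemma dotv_trmx m d (M : 'M[R]_(m, d)) u v :
  dotv (M^T *m u) v = dotv u (M *m v).
Proof.
have dotv_mul k (x y : 'cV[R]_k) : dotv x y = (x^T *m y) 0 0.
  by rewrite mxE; apply: eq_bigr => i _; rewrite mxE.
by rewrite !dotv_mul trmx_mul trmxK mulmxA.
Qed.

Definition dotvE := (dotvDl, dotvDr, dotvNl, dotvNr, dotvZl, dotvZr).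

Lemma sqn_ge0 d (u : 'cV[R]_d) : 0 <= sqn u.
Proof. by apply: sumr_ge0 => i _; rewrite -expr2 sqr_ge0. Qed.

Lemma sqn_entry d (u : 'cV[R]_d) i : u i 0 ^+ 2 <= sqn u.
Proof.
rewrite /dotv (bigD1 i) //= expr2 lerDl.
by apply: sumr_ge0 => j _; rewrite -expr2 sqr_ge0.
Qed.

Lemma sqn_eq0 d (u : 'cV[R]_d) : sqn u = 0 -> u = 0.
Proof.
move=> u0; apply/colP => i; rewrite mxE; apply/eqP; rewrite -sqrf_eq0.
by rewrite eq_le sqr_ge0 andbT -u0 sqn_entry.
Qed.

Lemma l2norm_sqr d (u : 'cV[R]_d) : l2norm u ^+ 2 = sqn u.
Proof. by rewrite sqr_sqrtr ?sqn_ge0. Qed.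

Lemma sqnD_le d (u v : 'cV[R]_d) : sqn (u + v) <= 2 * sqn u + 2 * sqn v.
Proof.
have := sqn_ge0 (u - v); rewrite !dotvE (dotvC v u); lra.
Qed.

(** Expand the square and bound each mixed product by
    2 <u, v> <= |u|^2 + |v|^2. *)
Lemma sqn_sum d n (u : 'I_n -> 'cV[R]_d) :
  sqn (\sum_i u i) <= n%:R * \sum_i sqn (u i).
Proof.
rewrite dotv_suml; under eq_bigr do rewrite dotv_sumr.
have -> : n%:R * \sum_i sqn (u i) =
    \sum_(i < n) \sum_(j < n) (sqn (u i) / 2 + sqn (u j) / 2).
  under [RHS]eq_bigr do rewrite big_split /= sumr_const card_ord -mulr_suml.
  rewrite big_split /= sumr_const card_ord sumrMnl -!mulr_suml.
  by rewrite -[X in _ = X + _]mulr_natr -[X in _ = _ + X]mulr_natr; field.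
apply: ler_sum => i _; apply: ler_sum => j _.
have := sqn_ge0 (u i - u j); rewrite !dotvE (dotvC (u j) (u i)); lra.
Qed.

(** Without such a bound the supremum in [opnorm] would carry no information.
    As M x is a combination of the columns of M, [sqn_sum] gives it. *)
Lemma sqn_mulmx_bounded m d (M : 'M[R]_(m, d)) :
  exists2 C, 0 <= C & forall x, sqn (M *m x) <= C * sqn x.
Proof.
exists (d%:R * \sum_j sqn (col j M)) => [|x].
  by rewrite mulr_ge0 // sumr_ge0 // => j _; exact: sqn_ge0.
have -> : M *m x = \sum_j x j 0 *: col j M.
  by apply/colP => i; rewrite summxE mxE; apply: eq_bigr => j _; rewrite !mxE mulrC.
apply: le_trans (sqn_sum _) _; rewrite -mulrA ler_wpM2l //.
rewrite mulr_suml; apply: ler_sum => j _; rewrite !dotvE mulrA mulrC.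
by rewrite ler_wpM2l ?sqn_ge0 // -expr2 sqn_entry.
Qed.

Lemma sqn_mulmx_opnorm m d (M : 'M[R]_(m, d)) x :
  sqn (M *m x) <= opnorm M ^+ 2 * sqn x.
Proof.
have [x0|xN0] := eqVneq (sqn x) 0.
  by rewrite x0 (sqn_eq0 x0) mulmx0 dotv0l mulr0.
have l2_gt0 : 0 < l2norm x by rewrite sqrtr_gt0 lt_neqAle eq_sym xN0 sqn_ge0.
pose y := (l2norm x)^-1 *: x.
have y1 : sqn y = 1.
  by rewrite !dotvE -l2norm_sqr mulrA -expr2 exprVn mulVf // sqrf_eq0 gt_eqF.
have -> : M *m x = l2norm x *: (M *m y).
  by rewrite -scalemxAr scalerA mulfV ?gt_eqF // scale1r.
rewrite !dotvE mulrA -expr2 l2norm_sqr mulrC ler_wpM2r ?sqn_ge0 //.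
have [C C_ge0 MC] := sqn_mulmx_bounded M.
have My_le : l2norm (M *m y) <= opnorm M.
  apply: ub_le_sup; last by exists y => //=; rewrite /l2norm y1 sqrtr1.
  exists (Num.sqrt C) => _ [z z1 <-]; apply: ler_wsqrtr.
  apply: le_trans (MC z) _; rewrite -[leRHS]mulr1 ler_wpM2l //.
  by rewrite -l2norm_sqr exprn_ile1 // sqrtr_ge0.
by rewrite -l2norm_sqr lerXn2r // nnegrE ?(le_trans _ My_le) // sqrtr_ge0.
Qed.

End InnerProduct.

(** * Limits of column vectors *)

Section Topology.
Context {R : realType} {T : Type} {F : set_system T} {FF : Filter F}.

Lemma cvg_col d (u : T -> 'cV[R]_d) (l : 'cV[R]_d) :
  u @ F --> l <-> forall i, u t i 0 @[t --> F] --> l i 0.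
Proof.
split=> [ul i|ul].
  exact: (cvg_comp u (fun v : 'cV[R]_d => v i 0) ul (@coord_continuous _ _ _ i 0 l)).
apply/cvg_ballP => e e_gt0.
have near_l : \forall t \near F, forall i, ball (l i 0) e (u t i 0).
  by apply: filter_forall => i; exact: (cvg_ball (ul i)).
by apply: filterS near_l => t tl; split=> // i j; rewrite ord1; exact: tl.
Qed.

Lemma cvg_sum (I : finType) (w : I -> T -> R) (l : I -> R) :
  (forall i, w i @ F --> l i) -> \sum_i w i t @[t --> F] --> \sum_i l i.
Proof. by move=> wl; apply: cvg_big => //; exact: add_continuous. Qed.

Lemma cvg_dotv d (u v : T -> 'cV[R]_d) (a b : 'cV[R]_d) :
  u @ F --> a -> v @ F --> b -> dotv (u t) (v t) @[t --> F] --> dotv a b.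
Proof.
move=> /cvg_col ua /cvg_col vb.
by apply: cvg_sum => i; apply: cvgM.
Qed.

Lemma cvg_mulmx m d (M : 'M[R]_(m, d)) (u : T -> 'cV[R]_d) (a : 'cV[R]_d) :
  u @ F --> a -> M *m u t @[t --> F] --> M *m a.
Proof.
move=> /cvg_col ua; apply/cvg_col => i.
under eq_fun do rewrite mxE; rewrite mxE.
by apply: cvg_sum => j; apply: cvgM => //; exact: cvg_cst.
Qed.

(** Links the Euclidean norm of the estimates with the topology of column
    vectors, defined from the sup norm: each entry is controlled by [sqn]. *)
Lemma cvg_sqn d (u : T -> 'cV[R]_d) (l : 'cV[R]_d) :
  sqn (u t - l) @[t --> F] --> (0 : R) -> u @ F --> l.
Proof.
move=> ul; apply/cvg_col => i; apply/cvgrPdist_lt => e e_gt0.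
have e2_gt0 : 0 < e ^+ 2 by rewrite exprn_gt0.
near=> t; have ut : sqn (u t - l) < e ^+ 2 by near: t; exact: cvgr_lt ul _ e2_gt0.
have := le_lt_trans (sqn_entry (u t - l) i) ut; rewrite !mxE ltr_norml; nra.
Unshelve. all: by end_near. Qed.

End Topology.

Section UltraLimits.
Context {R : realType} {T : Type} {U : set_system T} {UU : UltraFilter U}.

(** Unlike [ultra_image], this needs no surjectivity: a filter finer than the
    image cannot contain a set whose preimage is outside U, since the
    complement of that preimage is then in U. *)
Lemma ultra_map (Y : Type) (g : T -> Y) : UltraFilter (g @ U).
Proof.
split=> [|G GG sG]; first exact: fmap_proper_filter.
apply/seteqP; split=> // B GB; have [//|UnB] := in_ultra_setVsetC (g @^-1` B) UU.
have GnB : G (~` B) by apply: sG.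
by have /filter_ex [? []] : G (B `&` ~` B) by exact: filterI.
Qed.

(** Bolzano-Weierstrass along an ultrafilter: each coordinate stays in a
    segment, and an ultrafilter on a compact set converges. *)
Lemma ultra_cvg d (u : T -> 'cV[R]_d) (v : 'cV[R]_d) C :
  (forall t, sqn (u t - v) <= C) -> u @ U --> lim (u @ U).
Proof.
move=> uC.
have coord_cvg i : exists l : R, u t i 0 @[t --> U] --> l.
  have := @segment_compact R (v i 0 - (C + 1)) (v i 0 + (C + 1)).
  rewrite compact_ultra => /(_ _ (ultra_map (fun t => u t i 0))) [|l [_ ul]].
    (* |w| <= w ^ 2 + 1 spares a square root in the bounds of the segment *)
    apply: (@filterE _ U) => t /=; rewrite in_itv /=.
    have := le_trans (sqn_entry (u t - v) i) (uC t); rewrite !mxE.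
    have := sqr_ge0 (u t i 0 - v i 0 - 1); have := sqr_ge0 (u t i 0 - v i 0 + 1).
    by move=> ? ? ?; apply/andP; split; nra.
  by exists l.
have [l ul] := choice coord_cvg.
by apply/cvg_ex; exists (\col_i l i); apply/cvg_col => i; rewrite mxE.
Qed.

End UltraLimits.

(** * Subdifferentials and proximal steps *)

Section Subdifferentials.
Context {R : realType}.

Lemma ge0_of_affine_ge0 (a b : R) :
  (forall t, 0 < t < 1 -> 0 <= a + t * b) -> 0 <= a.
Proof.
move=> ab; rewrite leNgt; apply/negP => a_lt0.
have b_gt0 : 0 < `|b| + 1 by rewrite ltr_wpDl.
(* small enough for t * b not to compensate half of the negative a *)
pose t := Num.min (1 / 2) (- a / (2 * (`|b| + 1))).
have t_gt0 : 0 < t.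
  by rewrite lt_min divr_gt0 //= divr_gt0 ?oppr_gt0 // mulr_gt0.
have t_lt1 : t < 1 by rewrite gt_min; apply/orP; left; lra.
have := ab t; rewrite t_gt0 t_lt1 => /(_ isT).
have : t * (2 * (`|b| + 1)) <= - a.
  by rewrite -ler_pdivlMr ?mulr_gt0 // ge_min lexx orbT.
have := ler_norm b; nra.
Qed.

Lemma subdiff_fin d (f : 'cV[R]_d -> \bar R) x g :
  proper_fun f -> subdiff f x g -> f x \is a fin_num.
Proof.
move=> [fN [z fz]] /(_ z) /le_lt_trans /(_ fz).
by case: (f x) (fN x).
Qed.

(** Compare the minimizer p with the points of the segment from p to y: convexity
    bounds f linearly along it, the quadratic term contributes its derivative
    c <p - u, y - p> to first order, and the slope at p must be
    nonnegative. *)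
Lemma prox_subdiff d (f : 'cV[R]_d -> \bar R) c u p :
  proper_fun f -> convex_efun f -> 0 < c ->
  is_argmin (fun x => (f x + (c / 2 * sqn (x - u))%:E)%E) p ->
  subdiff f p (c *: (u - p)).
Proof.
move=> [fN [z fz]] f_conv c_gt0 p_min.
have [a fpa] : exists a, f p = a%:E.
  have := p_min z; case: (f z) (fN z) fz => // r _ _.
  by case: (f p) (fN p) => // a _ _; exists a.
move=> y; rewrite fpa; have := f_conv y p; case fy : (f y) (fN y) => [r||] //.
  move=> _ f_seg; rewrite -EFinD lee_fin -subr_ge0.
  apply: (@ge0_of_affine_ge0 _ (c / 2 * sqn (y - p))) => t /andP[t_gt0 t_lt1].
  have := p_min (t *: y + (1 - t) *: p); have := f_seg t.
  rewrite t_gt0 t_lt1 fpa => /(_ isT); rewrite -!EFinM -EFinD.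
  case: (f _) (fN (t *: y + (1 - t) *: p)) => // v _.
  rewrite -!EFinD !lee_fin => v_le.
  have -> : t *: y + (1 - t) *: p - u = (p - u) + t *: (y - p).
    by apply/colP => i; rewrite !mxE; ring.
  rewrite !dotvE !(dotvC _ p) !(dotvC u y).
  move=> le_v; rewrite -(pmulr_rge0 _ t_gt0); nra.
by move=> _; rewrite leey.
Qed.

(** Add the two subgradient inequalities; properness makes both values finite,
    so that they cancel. *)
Lemma subdiff_monotone d (f : 'cV[R]_d -> \bar R) x y g h :
  proper_fun f -> subdiff f x g -> subdiff f y h -> 0 <= dotv (g - h) (x - y).
Proof.
move=> f_prop fx fy.
have := fx y; have := fy x.
have /fineK <- := subdiff_fin f_prop fx; have /fineK <- := subdiff_fin f_prop fy.
rewrite -!EFinD !lee_fin !dotvE; lra.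
Qed.

Lemma indicator_proper d (X : set 'cV[R]_d) : X !=set0 -> proper_fun (indicator X).
Proof.
move=> [z Xz]; split=> [x|]; first by rewrite /indicator; case: ifP.
by exists z; rewrite /indicator mem_set.
Qed.

Lemma indicator_convex d (X : set 'cV[R]_d) : convex_set X -> convex_efun (indicator X).
Proof.
move=> cX x y t /andP[t_gt0 t_lt1]; rewrite /indicator.
have t1_gt0 : (0 < (1 - t)%:E)%E by rewrite lte_fin subr_gt0.
have t0' : (0 < t%:E)%E by rewrite lte_fin.
have [xX|xX] := boolP (x \in X); have [yX|yX] := boolP (y \in X);
  rewrite ?mule0 ?adde0 ?add0e ?gt0_muley ?leey //.
by have := cX x y (@Itv01 R t (ltW t_gt0) (ltW t_lt1)) xX yX => /= ->.
Qed.

Lemma indicator_lsc d (X : set 'cV[R]_d) :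
  closed X -> lower_semicontinuous (indicator X).
Proof.
move=> X_cl x a; rewrite {1}/indicator; case: ifPn => [_ a_lt0|xX _].
  exists setT; first exact: filterT.
  by move=> y _; rewrite /indicator; case: ifP => // _; rewrite ltry.
exists (~` X); last first.
  by move=> y Xy; rewrite /indicator memNset // ltry.
apply: open_nbhs_nbhs; split; first exact: closed_openC.
by rewrite notin_setE in xX.
Qed.

(** Lets the projected blocks be handled exactly as the proximal ones. *)
Lemma projection_argmin d (X : set 'cV[R]_d) c u p : 0 < c -> is_projection X u p ->
  is_argmin (fun x => (indicator X x + (c / 2 * sqn (x - u))%:E)%E) p.
Proof.
move=> c_gt0 [Xp p_min] y; rewrite /indicator mem_set //.
case: ifPn => [|_]; last by rewrite addye // leey.
rewrite inE => Xy; rewrite !add0e lee_fin ler_pM2l ?divr_gt0 //.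
have opp (v : 'cV[R]_d) : sqn (v - u) = sqn (u - v).
  by rewrite !dotvE !(dotvC _ v); ring.
rewrite !opp -!l2norm_sqr.
by rewrite lerXn2r // ?nnegrE ?sqrtr_ge0 //; exact: p_min.
Qed.

(** In f (u t) <= f y - <g t, y - u t> the right-hand side converges, and lower
    semicontinuity bounds f x by its limit. *)
Lemma subdiff_closed {T : Type} {F : set_system T} {FF : ProperFilter F}
  d (f : 'cV[R]_d -> \bar R) (u g : T -> 'cV[R]_d) (x h : 'cV[R]_d) :
  lower_semicontinuous f -> proper_fun f ->
  (forall t, subdiff f (u t) (g t)) ->
  u @ F --> x -> g @ F --> h -> subdiff f x h.
Proof.
move=> f_lsc f_prop fug ux gh y; rewrite leNgt; apply/negP.
have [fN _] := f_prop.
case fy : (f y) (fN y) => [r||] // _; last by rewrite ltNge leey.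
move=> r_lt.
have [c c_gt fc] : exists2 c, r - dotv h (y - x) < c & (c%:E < f x)%E.
  move: r_lt; case: (f x) => [v||] //; rewrite -?EFinD ?lte_fin => r_lt.
    exists ((r - dotv h (y - x) + v) / 2); rewrite ?lte_fin; lra.
  by exists (r - dotv h (y - x) + 1); rewrite ?ltry // ltrDl.
have [V xV Vc] := f_lsc x c fc.
have gap : r - dotv (g t) (y - u t) @[t --> F] --> r - dotv h (y - x).
  apply: cvgB; first exact: cvg_cst.
  by apply: cvg_dotv => //; apply: cvgB => //; exact: cvg_cst.
have : \forall t \near F, False; last by move/filter_ex => [].
near=> t.
have lt_c : r - dotv (g t) (y - u t) < c.
  by near: t; exact: cvgr_lt gap c c_gt.
have := fug t y; rewrite fy; have : (c%:E < f (u t))%E.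
  by apply: Vc; near: t; exact: ux.
case: (f _) => [v||] //; rewrite -?EFinD ?lee_fin ?lte_fin; lra.
Unshelve. all: by end_near. Qed.

End Subdifferentials.

(** * Sequences tending to 0 *)

Lemma cvg0_le {R : realType} {T : Type} {F : set_system T} {FF : Filter F}
    (c : R) (v w : T -> R) :
  (forall t, 0 <= w t <= c * v t) -> v @ F --> 0 -> w @ F --> 0.
Proof.
move=> wv v0; apply: (@squeeze_cvgr _ _ _ _ (cst 0) (fun t => c * v t)).
- exact: filterE.
- exact: cvg_cst.
- by rewrite -(mulr0 c); apply: cvgM v0; exact: cvg_cst.
Qed.

(** V converges, being monotone and bounded below, and r is dominated by its
    decrements. *)
Lemma decrement_cvg0 {R : realType} (V r : nat -> R) :
  (forall k, 0 <= V k) -> (forall k, 0 <= r k) ->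
  (forall k, V k.+1 + r k <= V k) -> r @ \oo --> 0.
Proof.
move=> V_ge0 r_ge0 Vr.
have V_cvg : cvgn V.
  apply: nonincreasing_is_cvgn; last by exists 0 => _ [k _ <-].
  by apply/nonincreasing_seqP => k; apply: le_trans (Vr k); rewrite lerDl.
apply: (@squeeze_cvgr _ _ _ _ (cst 0) (fun k => V k - V k.+1)).
- by apply: filterE => k; rewrite r_ge0 lerBrDl Vr.
- exact: cvg_cst.
- rewrite -(subrr (lim (V @ \oo))); apply: cvgB => //.
  by have := V_cvg; rewrite -{1}(cvg_shiftS V).
Qed.

(** * Descent and convergence *)

Unset Implicit Arguments.

Section Convergence.
Context {R : realType} {n m : nat} {d : 'I_n -> nat}.
Variables (f : forall i : 'I_n, 'cV[R]_(d i) -> \bar R).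
Variables (A : forall i : 'I_n, 'M[R]_(m, d i)) (b : 'cV[R]_m).
Variable X : forall i : 'I_n, set 'cV[R]_(d i).
Variables (eta eta' : 'I_n -> R).
Hypothesis f_cpc : forall i, closed_proper_convex (f i).
Hypothesis X_convex : forall i, convex_set (X i).
Hypothesis eta_gt : forall i, n%:R * opnorm (A i) ^+ 2 + 2 < eta i.
Hypothesis eta'_gt : forall i, 2 < eta' i.

Lemma eta_gt0 i : 0 < eta i.
Proof.
apply: lt_trans (eta_gt i); rewrite ltr_wpDl //.
by rewrite mulr_ge0 // sqr_ge0.
Qed.

Lemma eta'_gt0 i : 0 < eta' i.
Proof. exact: lt_trans (eta'_gt i). Qed.

(** The multipliers hat lambda of the algorithm: these enter the subgradients
    of a step, whereas [pmu] and [pnu] enter [lyapunov]. *)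
Definition predicted_mu beta (s : pdpoint R m d) : 'cV[R]_m :=
  pmu s + beta *: (Asum A (px s) - b).

Definition predicted_nu beta (s : pdpoint R m d) i : 'cV[R]_(d i) :=
  pnu s i + beta *: (px s i - py s i).

(** The dual distance is weighted by beta^-2 because a multiplier increment is
    beta times a constraint residual. *)
Definition lyapunov beta (p q : pdpoint R m d) : R :=
  \sum_i (eta i * sqn (px p i - px q i) + eta' i * sqn (py p i - py q i))
  + beta ^- 2 * (sqn (pmu p - pmu q) + \sum_i sqn (pnu p i - pnu q i)).

(** A lower bound on the loss of [lyapunov] in one step: what is left of the
    squared displacements after paying for the simultaneous update of the
    blocks, plus the squared constraint residuals at the old point. *)
Definition step_loss (s s' : pdpoint R m d) : R :=
  \sum_i ((eta i - (n%:R * opnorm (A i) ^+ 2 + 2)) * sqn (px s' i - px s i)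
    + (eta' i - 2) * sqn (py s' i - py s i) + sqn (px s i - py s i))
  + sqn (Asum A (px s) - b).

Lemma Asum_sub x x' : Asum A x - Asum A x' = \sum_i A i *m (x i - x' i).
Proof. by rewrite /Asum -sumrB; apply: eq_bigr => i _; rewrite mulmxBr. Qed.

(** Rewrites the subgradient provided by [prox_subdiff], for the proximal
    centre x + c^-1 g, as a displacement plus a multiplier term. *)
Lemma prox_displacement {k} (c : R) (x x' g : 'cV[R]_k) : c != 0 ->
  - c *: (x' - x) + g = c *: (x + c^-1 *: g - x').
Proof. by move=> c0; apply/colP => j; rewrite !mxE; field. Qed.

Lemma step_subdiff_f {beta s s'} i :
  0 < beta -> ladmpsap_step f A b X eta eta' beta s s' ->
  subdiff (f i) (px s' i)
    (- (eta i * beta) *: (px s' i - px s i)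
     - ((A i)^T *m predicted_mu beta s + predicted_nu beta s i)).
Proof.
move=> beta_gt0 [xmin _ _ _]; have [_ f_prop f_conv] := f_cpc i.
have c_gt0 : 0 < eta i * beta by rewrite mulr_gt0 // eta_gt0.
set g := _ *m _ + _.
rewrite prox_displacement ?gt_eqF // scalerN.
have shift y e : y - (px s i - e) = y - px s i + e by rewrite opprB addrA addrAC.
apply: prox_subdiff => // y; rewrite !shift -!l2norm_sqr; exact: xmin.
Qed.

Lemma step_subdiff_X {beta s s'} i :
  0 < beta -> ladmpsap_step f A b X eta eta' beta s s' ->
  subdiff (indicator (X i)) (py s' i)
    (- (eta' i * beta) *: (py s' i - py s i) + predicted_nu beta s i).
Proof.
move=> beta_gt0 [_ yproj _ _].
have c_gt0 : 0 < eta' i * beta by rewrite mulr_gt0 // eta'_gt0.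
have X_prop : proper_fun (indicator (X i)).
  by apply: indicator_proper; exists (py s' i); case: (yproj i).
rewrite prox_displacement ?gt_eqF //.
apply: prox_subdiff => //; first exact: indicator_convex.
exact: projection_argmin.
Qed.

Lemma primal_identity {k} (x x' z : 'cV[R]_k) :
  2 * dotv (x' - x) (x' - z) = sqn (x' - z) - sqn (x - z) + sqn (x' - x).
Proof. by rewrite !dotvE (dotvC x x') !(dotvC z); ring. Qed.

(** Take r and r' to be the residuals of a constraint before and after the step:
    then l + beta r is the predicted multiplier and l + beta r' the next one.
    The pairing on the left, produced by the subgradients, is the variation of
    the weighted squared distance to z, up to a gain [sqn r] and to the cost
    [sqn (r' - r)] of using a prediction. *)
Lemma dual_identity {k} beta (l z r r' : 'cV[R]_k) : beta != 0 ->
  2 * beta^-1 * dotv (l + beta *: r - z) r' =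
    beta ^- 2 * (sqn (l + beta *: r' - z) - sqn (l - z)) + sqn r - sqn (r' - r).
Proof.
move=> beta0; rewrite !dotvE !(dotvC r') !(dotvC z); by field.
Qed.

(** In each block, monotonicity of the subdifferential at the new point and at q
    gives an inequality where the displacement terms obey [primal_identity];
    summed over the blocks, the multiplier terms obey [dual_identity], since
    the images of the primal errors under the constraint map add up to the
    residual at the new point, q being feasible. *)
Lemma lyapunov_descent {beta s s' q} :
  0 < beta -> ladmpsap_step f A b X eta eta' beta s s' -> is_KKT f A b X q ->
  lyapunov beta s' q + step_loss s s' <= lyapunov beta s q.
Proof.
move=> beta_gt0 stp [qb qxy qf qX]; have beta0 : beta != 0 by rewrite gt_eqF.
pose w := predicted_mu beta s - pmu q.
have block i :
    eta i * (sqn (px s' i - px q i) - sqn (px s i - px q i) + sqn (px s' i - px s i))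
    + eta' i * (sqn (py s' i - py q i) - sqn (py s i - py q i)
       + sqn (py s' i - py s i))
    + 2 * beta^-1 * dotv w (A i *m (px s' i - px q i))
    + 2 * beta^-1 * dotv (predicted_nu beta s i - pnu q i) (px s' i - py s' i) <= 0.
  have [_ f_prop _] := f_cpc i.
  have X_prop : proper_fun (indicator (X i)).
    by apply: indicator_proper; exists (py s' i); case: stp => _ /(_ i) [].
  have := subdiff_monotone X_prop (step_subdiff_X i beta_gt0 stp) (qX i).
  have := subdiff_monotone f_prop (step_subdiff_f i beta_gt0 stp) (qf i).
  have -> : px q i = py q i by apply/eqP; rewrite -subr_eq0 qxy.
  rewrite -!primal_identity -dotv_trmx /w mulmxBr.
  have bK t : beta * (2 * beta^-1 * t) = 2 * t by field.
  set g := _ *m predicted_mu _ _; set g' := _ *m pmu q.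
  set h := predicted_nu _ _ _; set h' := pnu q i.
  set dx := px s' i - px s i; set dy := py s' i - py s i.
  have -> : px s' i - py s' i = (px s' i - py q i) - (py s' i - py q i).
    by rewrite opprB addrA subrK.
  set u := px s' i - py q i; set v := py s' i - py q i.
  move=> fmon Xmon; rewrite -(pmulr_rle0 _ beta_gt0) !mulrDr !bK.
  move: fmon Xmon; rewrite !dotvE; lra.
have dual_mu := dual_identity beta (pmu s) (pmu q)
  (Asum A (px s) - b) (Asum A (px s') - b) beta0.
have op_dx i : sqn (A i *m (px s' i - px s i))
    <= opnorm (A i) ^+ 2 * sqn (px s' i - px s i) := sqn_mulmx_opnorm _ _.
(* the cost of the simultaneous update in the coupling constraint *)
have op_sum : sqn ((Asum A (px s') - b) - (Asum A (px s) - b)) <=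
    \sum_i n%:R * opnorm (A i) ^+ 2 * sqn (px s' i - px s i).
  rewrite opprB addrA subrK Asum_sub; apply: le_trans (sqn_sum _) _.
  rewrite mulr_sumr; apply: ler_sum => i _; by rewrite -mulrA ler_wpM2l.
have sum_w : dotv w (Asum A (px s') - b) = \sum_i dotv w (A i *m (px s' i - px q i)).
  by rewrite -qb Asum_sub dotv_sumr.
have [_ _ mu' nu'] := stp.
rewrite -mu' -/(predicted_mu beta s) -/w sum_w in dual_mu.
rewrite /lyapunov /step_loss.
have blocks : \sum_i (
    eta i * sqn (px s' i - px q i) + eta' i * sqn (py s' i - py q i)
    + beta ^- 2 * sqn (pnu s' i - pnu q i)
    + ((eta i - (n%:R * opnorm (A i) ^+ 2 + 2)) * sqn (px s' i - px s i)
      + (eta' i - 2) * sqn (py s' i - py s i) + sqn (px s i - py s i))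
    + n%:R * opnorm (A i) ^+ 2 * sqn (px s' i - px s i)
    + 2 * beta^-1 * dotv w (A i *m (px s' i - px q i))) <=
  \sum_i (eta i * sqn (px s i - px q i) + eta' i * sqn (py s i - py q i)
    + beta ^- 2 * sqn (pnu s i - pnu q i)).
  apply: ler_sum => i _; have := block i.
  rewrite [X in _ + X <= 0](dual_identity beta _ _ (px s i - py s i)) // -nu'.
  have -> : px s' i - py s' i - (px s i - py s i) =
      (px s' i - px s i) - (py s' i - py s i) by apply/colP => j; rewrite !mxE; ring.
  (* the cost of the simultaneous update in the constraint x_i = y_i *)
  have := sqnD_le (px s' i - px s i) (- (py s' i - py s i)).
  rewrite [sqn (- _)]dotvNl dotvNr opprK; lra.
move: blocks; rewrite !big_split /= -!mulr_sumr; lra.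
Qed.

Lemma lyapunov_le beta beta' p q : 0 < beta -> beta <= beta' ->
  lyapunov beta' p q <= lyapunov beta p q.
Proof.
move=> beta_gt0 le_beta; rewrite lerD2l ler_wpM2r //.
  by rewrite addr_ge0 ?sqn_ge0 // sumr_ge0 // => i _; exact: sqn_ge0.
have beta'_gt0 := lt_le_trans beta_gt0 le_beta.
by rewrite lef_pV2 ?posrE ?exprn_gt0 // lerXn2r // nnegrE ltW.
Qed.

(** This turns a bound on [lyapunov] into a bound on the iterates, and its
    convergence to 0 into the convergence of the iterates.  Only the multipliers require the upper bound B on beta. *)
Lemma dist_le_lyapunov {beta} B p q : 0 < beta <= B ->
  [/\ forall i, sqn (px p i - px q i) <= (eta i)^-1 * lyapunov beta p q,
     forall i, sqn (py p i - py q i) <= (eta' i)^-1 * lyapunov beta p q,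
     sqn (pmu p - pmu q) <= B ^+ 2 * lyapunov beta p q
   & forall i, sqn (pnu p i - pnu q i) <= B ^+ 2 * lyapunov beta p q].
Proof.
case/andP=> beta_gt0 beta_le; rewrite /lyapunov.
set xy := fun i => eta i * sqn (px p i - px q i) + eta' i * sqn (py p i - py q i).
set L := sqn (pmu p - pmu q); set N := fun i => sqn (pnu p i - pnu q i).
have x_ge0 i : 0 <= eta i * sqn (px p i - px q i).
  by rewrite mulr_ge0 ?sqn_ge0 // ltW // eta_gt0.
have y_ge0 i : 0 <= eta' i * sqn (py p i - py q i).
  by rewrite mulr_ge0 ?sqn_ge0 // ltW // eta'_gt0.
have xy_ge0 i : 0 <= xy i by rewrite addr_ge0.
have xy_le i : xy i <= \sum_j xy j.
  by rewrite (bigD1 i) //= lerDl sumr_ge0.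
have N_ge0 i : 0 <= N i by exact: sqn_ge0.
have N_le i : N i <= \sum_j N j.
  by rewrite (bigD1 i) //= lerDl sumr_ge0.
have L_ge0 : 0 <= L by exact: sqn_ge0.
have sN_ge0 : 0 <= \sum_j N j by exact: sumr_ge0.
have sxy_ge0 : 0 <= \sum_j xy j by exact: sumr_ge0.
have dual_ge0 : 0 <= beta ^- 2 * (L + \sum_j N j).
  by rewrite mulr_ge0 ?addr_ge0 // invr_ge0 sqr_ge0.
have dual_le : L + \sum_j N j <=
    B ^+ 2 * (\sum_j xy j + beta ^- 2 * (L + \sum_j N j)).
  have B2_ge : beta ^+ 2 <= B ^+ 2.
    by rewrite lerXn2r // nnegrE ltW // (lt_le_trans beta_gt0).
  apply: le_trans (ler_wpM2r _ B2_ge); last exact: addr_ge0.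
  by rewrite mulrDr mulVKf ?gt_eqF ?exprn_gt0 // lerDr mulr_ge0 // sqr_ge0.
have xyV i : xy i <= \sum_j xy j + beta ^- 2 * (L + \sum_j N j).
  by apply: le_trans (xy_le i) _; rewrite lerDl.
split=> [i|i||i].
- by rewrite ler_pdivlMl ?eta_gt0 //; apply: le_trans (xyV i); rewrite lerDl.
- by rewrite ler_pdivlMl ?eta'_gt0 //; apply: le_trans (xyV i); rewrite lerDr.
- by apply: le_trans dual_le; rewrite lerDl.
- by apply: le_trans dual_le; apply: ler_wpDl L_ge0 (N_le i).
Qed.

Lemma lyapunov_ge0 {beta} p q : 0 < beta -> 0 <= lyapunov beta p q.
Proof.
move=> beta_gt0; have beta_le : 0 < beta <= beta by rewrite beta_gt0 lexx.
have [_ _ /(le_trans (sqn_ge0 _)) + _] := dist_le_lyapunov beta p q beta_le.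
by rewrite pmulr_rge0 // exprn_gt0.
Qed.

Lemma dist_le_step_loss s s' :
  [/\ 0 <= step_loss s s',
     forall i, sqn (px s' i - px s i) <=
       (eta i - (n%:R * opnorm (A i) ^+ 2 + 2))^-1 * step_loss s s',
     forall i, sqn (py s' i - py s i) <= (eta' i - 2)^-1 * step_loss s s',
     sqn (Asum A (px s) - b) <= step_loss s s'
   & forall i, sqn (px s i - py s i) <= step_loss s s'].
Proof.
rewrite /step_loss; set T := fun i =>
  (eta i - (n%:R * opnorm (A i) ^+ 2 + 2)) * sqn (px s' i - px s i)
  + (eta' i - 2) * sqn (py s' i - py s i) + sqn (px s i - py s i).
have c_gt0 i : 0 < eta i - (n%:R * opnorm (A i) ^+ 2 + 2) by rewrite subr_gt0.
have c'_gt0 i : 0 < eta' i - 2 by rewrite subr_gt0.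
have x_ge0 i : 0 <= (eta i - (n%:R * opnorm (A i) ^+ 2 + 2)) * sqn (px s' i - px s i).
  by rewrite mulr_ge0 ?sqn_ge0 // ltW.
have y_ge0 i : 0 <= (eta' i - 2) * sqn (py s' i - py s i).
  by rewrite mulr_ge0 ?sqn_ge0 // ltW.
have r_ge0 i : 0 <= sqn (px s i - py s i) by exact: sqn_ge0.
have T_ge0 i : 0 <= T i by rewrite !addr_ge0.
have T_le i : T i <= \sum_j T j + sqn (Asum A (px s) - b).
  rewrite (bigD1 i) //= -addrA lerDl addr_ge0 ?sqn_ge0 //.
  by apply: sumr_ge0 => j _.
split=> [|i|i||i].
- by apply: addr_ge0; [apply: sumr_ge0 => i _; exact: T_ge0|exact: sqn_ge0].
- rewrite ler_pdivlMl //; apply: le_trans (T_le i).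
  by rewrite /T -addrA lerDl addr_ge0.
- rewrite ler_pdivlMl //; apply: le_trans (T_le i).
  by rewrite /T -addrA addrCA lerDl addr_ge0.
- by rewrite lerDr; apply: sumr_ge0 => i _; exact: T_ge0.
- by apply: le_trans (T_le i); rewrite /T lerDr addr_ge0.
Qed.

Variables (beta : nat -> R) (s : nat -> pdpoint R m d).
Hypothesis beta_gt0 : forall k, 0 < beta k.
Hypothesis beta_nondecreasing : nondecreasing_seq beta.
Hypothesis beta_bounded : has_ubound (range beta).
Hypothesis X_closed : forall i, closed (X i).
Hypothesis s_step : forall k, ladmpsap_step f A b X eta eta' (beta k) (s k) (s k.+1).

Let V q k := lyapunov (beta k) (s k) q.

Lemma run_descent q k : is_KKT f A b X q ->
  V q k.+1 + step_loss (s k) (s k.+1) <= V q k.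
Proof.
move=> qKKT; apply: le_trans (lyapunov_descent (beta_gt0 k) (s_step k) qKKT).
by rewrite lerD2r lyapunov_le // beta_nondecreasing.
Qed.

Lemma run_nonincreasing q : is_KKT f A b X q -> nonincreasing_seq (V q).
Proof.
move=> qKKT; apply/nonincreasing_seqP => k.
apply: le_trans (run_descent q k qKKT); rewrite lerDl.
by case: (dist_le_step_loss (s k) (s k.+1)).
Qed.

Lemma step_loss_run_cvg0 q : is_KKT f A b X q ->
  step_loss (s k) (s k.+1) @[k --> \oo] --> 0.
Proof.
move=> qKKT; apply: (@decrement_cvg0 R (V q)
  (fun k => step_loss (s k) (s k.+1))) => k; last exact: run_descent.
  exact: lyapunov_ge0.
by case: (dist_le_step_loss (s k) (s k.+1)).
Qed.

Lemma run_cvg_of_lyapunov_cvg0 q : V q k @[k --> \oo] --> 0 -> point_cvg s q.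
Proof.
have [B betaB] := beta_bounded.
have beta_le k : 0 < beta k <= B by rewrite beta_gt0 betaB //; exists k.
move=> V0; split=> [i|i||i]; apply: cvg_sqn; apply: cvg0_le V0 => k;
  rewrite sqn_ge0 /=; have [Hx Hy Hmu Hnu] := dist_le_lyapunov B (s k) q (beta_le k).
- exact: Hx.
- exact: Hy.
- exact: Hmu.
- exact: Hnu.
Qed.

(** The penalty is frozen to a constant c, which makes [lyapunov] a continuous
    function of the iterate. *)
Lemma lyapunov_cvg0_of_cvg (U : set_system nat) (UU : ProperFilter U) c q :
  (forall i, px (s k) i @[k --> U] --> px q i) ->
  (forall i, py (s k) i @[k --> U] --> py q i) ->
  pmu (s k) @[k --> U] --> pmu q ->
  (forall i, pnu (s k) i @[k --> U] --> pnu q i) ->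
  lyapunov c (s k) q @[k --> U] --> 0.
Proof.
move=> xq yq muq nuq.
have sqn0 k (u : nat -> 'cV[R]_k) (v : 'cV[R]_k) :
    u @ U --> v -> sqn (u t - v) @[t --> U] --> (0 : R).
  move=> uv; rewrite -(dotv0l (0 : 'cV[R]_k)) -(subrr v).
  by apply: cvg_dotv; apply: cvgB => //; exact: cvg_cst.
have -> : 0 = \sum_(i < n) (eta i * 0 + eta' i * 0) +
    c ^- 2 * (0 + \sum_(i < n) 0) :> R.
  by rewrite !big1 ?(addr0, mulr0) // => i _; rewrite !mulr0 addr0.
apply: cvgD; first apply: cvg_sum => i.
  by apply: cvgD; apply: cvgM; [exact: cvg_cst|exact: sqn0|exact: cvg_cst|exact: sqn0].
apply: cvgM; first exact: cvg_cst.
by apply: cvgD; [exact: sqn0|apply: cvg_sum => i; exact: sqn0].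
Qed.

(** All four families of iterates are bounded and converge along the same
    ultrafilter.  The residuals vanish, so p is feasible and the predicted
    multipliers have the same limit as the actual ones; the displacements
    vanish, so new and old blocks have the same limit.  The subgradients of
    the steps then converge and [subdiff_closed] applies. *)
Lemma KKT_cluster q (U : set_system nat) (UU : UltraFilter U) :
  is_KKT f A b X q -> \oo `<=` U ->
  exists p, [/\ is_KKT f A b X p,
    forall i, px (s k) i @[k --> U] --> px p i,
    forall i, py (s k) i @[k --> U] --> py p i,
    pmu (s k) @[k --> U] --> pmu p
  & forall i, pnu (s k) i @[k --> U] --> pnu p i].
Proof.
move=> qKKT leU; have [B betaB] := beta_bounded.
have beta_le k : 0 < beta k <= B by rewrite beta_gt0 betaB //; exists k.
have V_le k : V q k <= V q 0%N by exact: run_nonincreasing.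
pose p := @PdPoint R n m d (fun i => lim (px (s k) i @[k --> U]))
  (fun i => lim (py (s k) i @[k --> U])) (lim (pmu (s k) @[k --> U]))
  (fun i => lim (pnu (s k) i @[k --> U])).
have px_p i : px (s k) i @[k --> U] --> px p i.
  apply: (@ultra_cvg _ _ _ _ _ _ (px q i) ((eta i)^-1 * V q 0%N)) => k.
  have [/(_ i) + _ _ _] := dist_le_lyapunov B (s k) q (beta_le k).
  by move=> /le_trans; apply; apply: ler_wpM2l (V_le k);
    rewrite invr_ge0 ltW // eta_gt0.
have py_p i : py (s k) i @[k --> U] --> py p i.
  apply: (@ultra_cvg _ _ _ _ _ _ (py q i) ((eta' i)^-1 * V q 0%N)) => k.
  have [_ /(_ i) + _ _] := dist_le_lyapunov B (s k) q (beta_le k).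
  by move=> /le_trans; apply; apply: ler_wpM2l (V_le k);
    rewrite invr_ge0 ltW // eta'_gt0.
have pmu_p : pmu (s k) @[k --> U] --> pmu p.
  apply: (@ultra_cvg _ _ _ _ _ _ (pmu q) (B ^+ 2 * V q 0%N)) => k.
  have [_ _ + _] := dist_le_lyapunov B (s k) q (beta_le k).
  by move=> /le_trans; apply; apply: ler_wpM2l (V_le k);
    rewrite sqr_ge0.
have pnu_p i : pnu (s k) i @[k --> U] --> pnu p i.
  apply: (@ultra_cvg _ _ _ _ _ _ (pnu q i) (B ^+ 2 * V q 0%N)) => k.
  have [_ _ _ /(_ i)] := dist_le_lyapunov B (s k) q (beta_le k).
  by move=> /le_trans; apply; apply: ler_wpM2l (V_le k);
    rewrite sqr_ge0.
have res0 : step_loss (s k) (s k.+1) @[k --> U] --> 0.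
  by apply: cvg_trans (step_loss_run_cvg0 q qKKT); exact: cvg_app.
have scaled0 k (a : nat -> R) (c : R) (u : nat -> 'cV[R]_k) :
    (forall t, 0 < a t <= c) ->
    sqn (u t) @[t --> U] --> (0 : R) -> a t *: u t @[t --> U] --> (0 : 'cV[R]_k).
  move=> ac u0; apply: cvg_sqn; apply: (cvg0_le (c := c ^+ 2)) u0 => t.
  have /andP[a_gt0 a_le] := ac t; rewrite subr0 sqn_ge0 dotvZl dotvZr mulrA /=.
  by rewrite ler_wpM2r ?sqn_ge0 // -expr2 lerXn2r // nnegrE ltW // (lt_le_trans a_gt0).
have dx0 i : sqn (px (s k.+1) i - px (s k) i) @[k --> U] --> (0 : R).
  apply: cvg0_le res0 => k; rewrite sqn_ge0 /=.
  by have [_ + _ _ _] := dist_le_step_loss (s k) (s k.+1); apply.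
have dy0 i : sqn (py (s k.+1) i - py (s k) i) @[k --> U] --> (0 : R).
  apply: cvg0_le res0 => k; rewrite sqn_ge0 /=.
  by have [_ _ + _ _] := dist_le_step_loss (s k) (s k.+1); apply.
have rmu0 : sqn (Asum A (px (s k)) - b) @[k --> U] --> (0 : R).
  apply: (cvg0_le (c := 1)) res0 => k; rewrite sqn_ge0 mul1r /=.
  by have [_ _ _ + _] := dist_le_step_loss (s k) (s k.+1).
have rnu0 i : sqn (px (s k) i - py (s k) i) @[k --> U] --> (0 : R).
  apply: (cvg0_le (c := 1)) res0 => k; rewrite sqn_ge0 mul1r /=.
  by have [_ _ _ _] := dist_le_step_loss (s k) (s k.+1); apply.
have px_next i : px (s k.+1) i @[k --> U] --> px p i.
  rewrite -(addr0 (px p i)).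
  have -> : (fun k => px (s k.+1) i) =
      (fun k => px (s k) i + (px (s k.+1) i - px (s k) i)).
    by apply/funext => k; rewrite addrC subrK.
  apply: cvgD (px_p i) _; apply: cvg_sqn; under eq_fun do rewrite subr0; exact: dx0.
have py_next i : py (s k.+1) i @[k --> U] --> py p i.
  rewrite -(addr0 (py p i)).
  have -> : (fun k => py (s k.+1) i) =
      (fun k => py (s k) i + (py (s k.+1) i - py (s k) i)).
    by apply/funext => k; rewrite addrC subrK.
  apply: cvgD (py_p i) _; apply: cvg_sqn; under eq_fun do rewrite subr0; exact: dy0.
have hmu_p : predicted_mu (beta k) (s k) @[k --> U] --> pmu p.
  by rewrite -(addr0 (pmu p)); apply: cvgD pmu_p _; exact: scaled0 rmu0.
have hnu_p i : predicted_nu (beta k) (s k) i @[k --> U] --> pnu p i.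
  by rewrite -(addr0 (pnu p i)); apply: cvgD (pnu_p i) _; exact: scaled0 (rnu0 i).
have lim_sqn0 k (u : nat -> 'cV[R]_k) (v : 'cV[R]_k) :
    u @ U --> v -> sqn (u t) @[t --> U] --> (0 : R) -> v = 0.
  move=> uv u0; apply: (cvg_unique (@norm_hausdorff R 'cV[R]_k) uv).
  by apply: cvg_sqn; under eq_fun do rewrite subr0.
exists p; split=> //; split=> [|i|i|i].
- apply/eqP; rewrite -subr_eq0; apply/eqP; apply: lim_sqn0 rmu0.
  apply: cvgB; last exact: cvg_cst.
  by apply: cvg_big => [|i _]; [exact: add_continuous|exact: cvg_mulmx].
- by apply: lim_sqn0 (rnu0 i); exact: cvgB (px_p i) (py_p i).
- have [f_lsc f_prop _] := f_cpc i.
  apply: (subdiff_closed f_lsc f_prop _ (px_next i)) => [k|].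
    exact: step_subdiff_f (beta_gt0 k) (s_step k).
  have -> : - ((A i)^T *m pmu p) - pnu p i = 0 - ((A i)^T *m pmu p + pnu p i).
    by rewrite sub0r opprD.
  apply: cvgB; last by apply: cvgD (hnu_p i); exact: cvg_mulmx hmu_p.
  under eq_fun do rewrite scaleNr; rewrite -oppr0; apply: cvgN.
  apply: (scaled0 _ _ (eta i * B)) (dx0 i) => k.
  by have /andP[? ?] := beta_le k; rewrite mulr_gt0 ?eta_gt0 //= ler_pM2l // eta_gt0.
- have X_prop : proper_fun (indicator (X i)).
    by apply: indicator_proper; exists (py (s 1%N) i);
      case: (s_step 0%N) => _ /(_ i) [].
  apply: (subdiff_closed (indicator_lsc (X_closed i)) X_prop _ (py_next i)) => [k|].
    exact: step_subdiff_X (beta_gt0 k) (s_step k).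
  rewrite -(add0r (pnu p i)); apply: cvgD (hnu_p i).
  under eq_fun do rewrite scaleNr; rewrite -oppr0; apply: cvgN.
  apply: (scaled0 _ _ (eta' i * B)) (dy0 i) => k.
  by have /andP[? ?] := beta_le k; rewrite mulr_gt0 ?eta'_gt0 //= ler_pM2l // eta'_gt0.
Qed.

(** [lyapunov] relative to the cluster point p is small for one iterate, because
    the sets of U are nonempty, and by monotonicity it stays small. *)
Theorem run_cvg : (exists q, is_KKT f A b X q) ->
  exists p, is_KKT f A b X p /\ point_cvg s p.
Proof.
move=> [q qKKT]; have [U [UU leU]] :=
  ultraFilterLemma (eventually_filter : ProperFilter \oo).
have [p [pKKT px_p py_p pmu_p pnu_p]] := KKT_cluster q U UU qKKT leU.
exists p; split=> //; apply: run_cvg_of_lyapunov_cvg0.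
have V0 := lyapunov_cvg0_of_cvg U _ (beta 0%N) p px_p py_p pmu_p pnu_p.
apply/cvgrPdist_lt => e e_gt0.
have [k0 k0e] : exists k, lyapunov (beta 0%N) (s k) p < e.
  have near_e : \forall k \near U, lyapunov (beta 0%N) (s k) p < e.
    by apply: cvgr_lt e_gt0; exact: V0.
  exact: filter_ex near_e.
near=> k; rewrite sub0r normrN ger0_norm ?lyapunov_ge0 //.
apply: le_lt_trans k0e; apply: (@le_trans _ _ (V p k0)).
  by apply: run_nonincreasing => //; near: k; exact: nbhs_infty_ge.
by apply: lyapunov_le => //; exact: beta_nondecreasing.
Unshelve. all: by end_near. Qed.

End Convergence.

Theorem theorem5 (R : realType) (n m : nat) (d : 'I_n -> nat)
  (f : forall i : 'I_n, 'cV[R]_(d i) -> \bar R)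
  (A : forall i : 'I_n, 'M[R]_(m, d i)) (b : 'cV[R]_m)
  (X : forall i : 'I_n, set 'cV[R]_(d i))
  (f_cpc : forall i, closed_proper_convex (f i))
  (X_closed : forall i, closed (X i))
  (X_convex : forall i, convex_set (X i))
  (X_proper : forall i, X i `<` [set: 'cV[R]_(d i)])
  (A_neq0 : forall i, A i <> 0)
  (sol_nonunique : exists x x' : forall i : 'I_n, 'cV[R]_(d i),
     [/\ x <> x', Asum A x = b & Asum A x' = b])
  (A_onto : forall y : 'cV[R]_m, exists x, Asum A x = y)
  (b_interior : interior [set Asum A x | x in [set x | forall i, X i (x i)]] b)
  (KKT_exists : exists p, is_KKT f A b X p)
  (beta : nat -> R) (eta eta' : 'I_n -> R)
  (beta_gt0 : forall k, 0 < beta k)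
  (beta_nondecreasing : nondecreasing_seq beta)
  (beta_bounded : has_ubound (range beta))
  (eta_gt : forall i, n%:R * opnorm (A i) ^+ 2 + 2 < eta i)
  (eta'_gt : forall i, 2 < eta' i)
  (s : nat -> pdpoint R m d)
  (s_run : is_ladmpsap_run f A b X eta eta' beta s) :
  exists p, is_KKT f A b X p /\ point_cvg s p.
Proof.
by case: s_run => _ s_step; apply: run_cvg s_step KKT_exists.
Qed.
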